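(* Let $\alpha\ge0$ and $0\le\beta<1$. Every $f\in\mathcal{W}_{\mathcal{H}}^0(\alpha,\beta)$ is a close-to-convex harmonic mapping of $\mathbb{D}$; in particular it is univalent in $\mathbb{D}$.
   Context: Let $\mathbb{D}=\{z\in\mathbb{C}:|z|<1\}$. $\mathcal{H}^0$ denotes the class of harmonic maps $f=h+\overline{g}$ on $\mathbb{D}$, with $h,g$ analytic in $\mathbb{D}$, $h(z)=z+\sum_{n\ge2}a_nz^n$ and $g(z)=\sum_{n\ge2}b_nz^n$. For $\alpha\ge0$, $0\le\beta<1$, $\mathcal{W}_{\mathcal{H}}^0(\alpha,\beta)$ denotes the class of $f=h+\overline{g}\in\mathcal{H}^0$ such that $\Re\big(h'(z)+\alpha zh''(z)-\beta\big)>|g'(z)+\alpha zg''(z)|$ for all $z\in\mathbb{D}$. A harmonic map $f$ on $\mathbb{D}$ is close-to-convex if it is univalent and the complement of $f(\mathbb{D})$ can be written as a union of non-intersecting half-lines. *)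

(* Defs.v *)
From Stdlib Require Import Reals Lra ClassicalEpsilon.
Open Scope R_scope.

Definition Cplx : Type := (R * R)%type.
Definition Cre (z : Cplx) : R := fst z.
Definition Cim (z : Cplx) : R := snd z.
Definition C0 : Cplx := (0, 0).
Definition C1 : Cplx := (1, 0).
Definition RtoC (r : R) : Cplx := (r, 0).
Definition Cadd (z w : Cplx) : Cplx := (fst z + fst w, snd z + snd w).
Definition Copp (z : Cplx) : Cplx := (- fst z, - snd z).
Definition Csub (z w : Cplx) : Cplx := Cadd z (Copp w).
Definition Cmul (z w : Cplx) : Cplx :=
  (fst z * fst w - snd z * snd w, fst z * snd w + snd z * fst w).
Definition Cconj (z : Cplx) : Cplx := (fst z, - snd z).
Definition Cnorm (z : Cplx) : R := sqrt (fst z * fst z + snd z * snd z).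
Fixpoint Cpow (z : Cplx) (n : nat) : Cplx :=
  match n with O => C1 | S m => Cmul z (Cpow z m) end.

Definition inD (z : Cplx) : Prop := Cnorm z < 1.

Fixpoint psum (a : nat -> Cplx) (z : Cplx) (n : nat) : Cplx :=
  match n with
  | O => Cmul (a O) (Cpow z O)
  | S m => Cadd (psum a z m) (Cmul (a (S m)) (Cpow z (S m)))
  end.

Definition series_conv (a : nat -> Cplx) (z : Cplx) (l : Cplx) : Prop :=
  forall eps, eps > 0 -> exists N : nat, forall n, (n >= N)%nat ->
    Cnorm (Csub (psum a z n) l) < eps.

(* the sum of the power series (meaningful when it converges) *)
Definition series_sum (a : nat -> Cplx) (z : Cplx) : Cplx :=
  epsilon (inhabits C0) (fun l => series_conv a z l).

Definition dcoef (a : nat -> Cplx) (k : nat) : Cplx := Cmul (RtoC (INR (S k))) (a (S k)).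

(* analytic function on D given by its Taylor coefficients *)
Definition conv_on_D (a : nat -> Cplx) : Prop :=
  forall z, inD z -> exists l, series_conv a z l.

Definition pfun (a : nat -> Cplx) : Cplx -> Cplx := fun z => series_sum a z.
Definition pder (a : nat -> Cplx) : Cplx -> Cplx := pfun (dcoef a).
Definition pder2 (a : nat -> Cplx) : Cplx -> Cplx := pfun (dcoef (dcoef a)).

(* the class H^0 : h(z) = z + sum_{n>=2} a_n z^n, g(z) = sum_{n>=2} b_n z^n,
   both analytic in D *)
Definition in_H0 (a b : nat -> Cplx) : Prop :=
  a O = C0 /\ a 1%nat = C1 /\ b O = C0 /\ b 1%nat = C0 /\
  conv_on_D a /\ conv_on_D b.

Definition harm (a b : nat -> Cplx) : Cplx -> Cplx :=
  fun z => Cadd (pfun a z) (Cconj (pfun b z)).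

Definition in_WH0 (alpha beta : R) (a b : nat -> Cplx) : Prop :=
  in_H0 a b /\
  forall z, inD z ->
    Cre (Csub (Cadd (pder a z) (Cmul (RtoC alpha) (Cmul z (pder2 a z)))) (RtoC beta))
    > Cnorm (Cadd (pder b z) (Cmul (RtoC alpha) (Cmul z (pder2 b z)))).

Definition univalent_on_D (f : Cplx -> Cplx) : Prop :=
  forall z1 z2, inD z1 -> inD z2 -> f z1 = f z2 -> z1 = z2.

Definition halfline (p d : Cplx) (w : Cplx) : Prop :=
  exists t, t >= 0 /\ w = Cadd p (Cmul (RtoC t) d).

(* f univalent, and Cplx \ f(D) is a union of pairwise non-intersecting half-lines
   (a family Fam of half-lines, given by base point and nonzero direction;
   two members are either the same half-line or disjoint) *)
Definition close_to_convex (f : Cplx -> Cplx) : Prop :=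
  univalent_on_D f /\
  exists Fam : Cplx -> Cplx -> Prop,
    (forall p d, Fam p d -> d <> C0) /\
    (forall w, (~ exists z, inD z /\ f z = w) <->
               exists p d, Fam p d /\ halfline p d w) /\
    (forall p1 d1 p2 d2, Fam p1 d1 -> Fam p2 d2 ->
       (forall w, halfline p1 d1 w <-> halfline p2 d2 w) \/
       (forall w, ~ (halfline p1 d1 w /\ halfline p2 d2 w))).

(* Main.v *)
(** The condition gives [Re (h' + e g') > 0] for every unit number [e]: along a radius, [Re (h' + e g')]
    satisfies [q + alpha r q' > 0] with [q 0 = 1], so it is positive at its minimum. Hence [f] is
    strictly monotone for the real scalar product, [<f z2 - f z1, z2 - z1> > 0], and so univalent.

    By Minty's argument, every [w] admits a [zeta] in the closed disc with
    [<w - f z, zeta - z> >= 0] for all [z] in the disc (the value at [zeta] of the maximal monotone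
    extension of [f] contains [w]). If [|zeta| < 1] this forces [f zeta = w]; otherwise [w] is not
    in the image. So the complement of the image is the disjoint union, over the unit circle, of the
    sets of those [w] solved by [zeta]; each is closed, invariant under [w |-> w + t zeta] for
    [t >= 0] and bounded in the direction [- zeta], hence a union of half-lines of direction
    [zeta]. *)

From Coquelicot Require Import Rcomplements Rbar Hierarchy Lim_seq Series PSeries Compactness.
From Coquelicot Require Complex.
From Stdlib Require Import Reals Lra Lia List Classical ClassicalEpsilon.
Require Import Defs.
Open Scope R_scope.

(** * Complex arithmetic and the norm *)

Lemma Cplx_ring_theory : ring_theory C0 C1 Cadd Cmul Csub Copp eq.
Proof.
split; intros; repeat match goal with z : Cplx |- _ => destruct z end;
  unfold Csub, Cadd, Cmul, Copp, C0, C1; simpl; f_equal; ring.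
Qed.
Add Ring Cplx_ring : Cplx_ring_theory.

Lemma Cnorm_Cmod (z : Cplx) : Cnorm z = Complex.Cmod z.
Proof. unfold Cnorm, Complex.Cmod; f_equal; ring. Qed.

Lemma Cnorm_ge0 (z : Cplx) : 0 <= Cnorm z.
Proof. apply sqrt_pos. Qed.

Lemma Cnorm_mul (z w : Cplx) : Cnorm (Cmul z w) = Cnorm z * Cnorm w.
Proof. rewrite !Cnorm_Cmod; apply Complex.Cmod_mult. Qed.

Lemma Cnorm_add (z w : Cplx) : Cnorm (Cadd z w) <= Cnorm z + Cnorm w.
Proof. rewrite !Cnorm_Cmod; apply Complex.Cmod_triangle. Qed.

Lemma Cnorm_RtoC (r : R) : Cnorm (RtoC r) = Rabs r.
Proof. unfold Cnorm, RtoC; simpl; rewrite <- sqrt_Rsqr_abs; unfold Rsqr; f_equal; ring. Qed.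

Lemma Cnorm_pow (z : Cplx) (n : nat) : Cnorm (Cpow z n) = Cnorm z ^ n.
Proof.
induction n as [|n IH]; simpl; [|rewrite Cnorm_mul, IH; reflexivity].
change C1 with (RtoC 1); rewrite Cnorm_RtoC; apply Rabs_R1.
Qed.

Lemma Rabs_fst_le (z : Cplx) : Rabs (fst z) <= Cnorm z.
Proof.
rewrite Cnorm_Cmod; eapply Rle_trans; [apply Rmax_l | apply Complex.Rmax_Cmod].
Qed.

Lemma Rabs_snd_le (z : Cplx) : Rabs (snd z) <= Cnorm z.
Proof.
rewrite Cnorm_Cmod; eapply Rle_trans; [apply Rmax_r | apply Complex.Rmax_Cmod].
Qed.

Lemma Cnorm_le_sum (z : Cplx) : Cnorm z <= Rabs (fst z) + Rabs (snd z).
Proof.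
replace z with (Cadd (RtoC (fst z)) (Cmul (0, 1) (RtoC (snd z)))) at 1
  by (destruct z; unfold Cadd, Cmul, RtoC; simpl; f_equal; ring).
eapply Rle_trans; [apply Cnorm_add|]; rewrite Cnorm_mul, !Cnorm_RtoC.
replace (Cnorm (0, 1)) with 1; [lra|].
unfold Cnorm; simpl; rewrite <- sqrt_1 at 1; f_equal; ring.
Qed.

(** * Convergence of power series and the radius of convergence *)

Lemma series_conv_components (a : nat -> Cplx) (z l : Cplx) :
  series_conv a z l <->
  is_lim_seq (fun n => fst (psum a z n)) (fst l) /\
  is_lim_seq (fun n => snd (psum a z n)) (snd l).
Proof.
rewrite <- !is_lim_seq_spec; split.
- intros H; split; intros eps; destruct (H eps (cond_pos eps)) as [N HN];
    exists N; intros n Hn; (eapply Rle_lt_trans; [|apply (HN n Hn)]).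
  + apply (Rabs_fst_le (Csub (psum a z n) l)).
  + apply (Rabs_snd_le (Csub (psum a z n) l)).
- intros [H1 H2] eps Heps.
  assert (Heps2 : 0 < eps / 2) by lra.
  destruct (H1 (mkposreal _ Heps2)) as [N1 HN1], (H2 (mkposreal _ Heps2)) as [N2 HN2].
  exists (max N1 N2); intros n Hn.
  eapply Rle_lt_trans; [apply Cnorm_le_sum|].
  assert (A1 := HN1 n ltac:(lia)); assert (A2 := HN2 n ltac:(lia)); simpl in *.
  unfold Rminus in *; lra.
Qed.

Lemma series_sum_conv (a : nat -> Cplx) (z : Cplx) :
  conv_on_D a -> inD z -> series_conv a z (pfun a z).
Proof.
intros Ha Hz; unfold pfun, series_sum.
apply (epsilon_spec (inhabits C0) (fun l => series_conv a z l)), Ha, Hz.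
Qed.

(** The squared norm is a polynomial in the two components, so the bound on it passes to the limit;
    the square root is taken only at the end. *)
Lemma Cnorm_lim_le (u : nat -> Cplx) (l : Cplx) (M : R) :
  is_lim_seq (fun n => fst (u n)) (fst l) -> is_lim_seq (fun n => snd (u n)) (snd l) ->
  (forall n, Cnorm (u n) <= M) -> Cnorm l <= M.
Proof.
intros H1 H2 HM.
assert (HM0 : 0 <= M) by (eapply Rle_trans; [apply Cnorm_ge0 | apply (HM O)]).
assert (H : fst l * fst l + snd l * snd l <= M * M).
{ assert (L := is_lim_seq_plus' _ _ _ _ (is_lim_seq_mult' _ _ _ _ H1 H1)
    (is_lim_seq_mult' _ _ _ _ H2 H2)).
  apply (is_lim_seq_le _ (fun _ => M * M) _ _ ) with (2 := L) (3 := is_lim_seq_const _).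
  intros n; rewrite <- sqrt_sqrt at 1 by nra.
  apply Rmult_le_compat; try apply sqrt_pos; apply (HM n). }
unfold Cnorm; rewrite <- (sqrt_square M) by exact HM0; apply sqrt_le_1_alt, H.
Qed.

(** Passing to the norms of the coefficients makes the real theory of [CV_radius] available for
    absolute convergence. *)
Definition radius_ge_1 (a : nat -> Cplx) : Prop :=
  Rbar_le 1 (CV_radius (fun n => Cnorm (a n))).

(** Were the radius [r] below 1, the series would converge at some [x] strictly between [r] and 1.
    Its partial sums are then bounded, hence so are its terms, as differences of consecutive partial
    sums; but bounded terms at [x] force [x <= r]. *)
Lemma conv_on_D_radius (a : nat -> Cplx) : conv_on_D a -> radius_ge_1 a.
Proof.
intros Ha; unfold radius_ge_1.
destruct (Rbar_le_lt_dec 1 (CV_radius (fun n => Cnorm (a n)))) as [H|H]; [exact H|exfalso].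
pose proof (CV_radius_ge_0 (fun n => Cnorm (a n))) as H0.
destruct (CV_radius_bounded (fun n => Cnorm (a n))) as [Hub _].
destruct (CV_radius (fun n => Cnorm (a n))) as [r| |]; try contradiction; simpl in *.
set (x := (1 + r) / 2); assert (Hx : r < x < 1) by (unfold x; lra).
assert (Hnx : Cnorm (RtoC x) = x) by (rewrite Cnorm_RtoC; apply Rabs_pos_eq; lra).
destruct (Ha (RtoC x)) as [l Hl]; [unfold inD; lra|].
apply (Rlt_not_le x r); [lra|]; apply (Hub x).
assert (Hb : exists B, forall n, Cnorm (psum a (RtoC x) n) <= B).
{ apply series_conv_components in Hl; destruct Hl as [L1 L2].
  apply is_lim_seq_Reals in L1; apply is_lim_seq_Reals in L2.
  destruct (maj_by_pos _ (exist _ _ L1)) as [B1 [_ HB1]].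
  destruct (maj_by_pos _ (exist _ _ L2)) as [B2 [_ HB2]].
  exists (B1 + B2); intros n; eapply Rle_trans; [apply Cnorm_le_sum|].
  apply Rplus_le_compat; auto. }
destruct Hb as [B HB]; exists (B + B); intros n.
rewrite Rabs_pos_eq
  by (apply Rmult_le_pos; [apply Cnorm_ge0 | apply pow_le; lra]).
rewrite <- Hnx at 1; rewrite <- Cnorm_pow, <- Cnorm_mul.
destruct n as [|n].
- pose proof (HB O) as H1; pose proof (Cnorm_ge0 (psum a (RtoC x) 0)).
  change (Cmul (a O) (Cpow (RtoC x) 0)) with (psum a (RtoC x) 0); lra.
- replace (Cmul (a (S n)) (Cpow (RtoC x) (S n)))
    with (Cadd (psum a (RtoC x) (S n)) (Cmul (Copp C1) (psum a (RtoC x) n)))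
    by (simpl; ring).
  eapply Rle_trans; [apply Cnorm_add|]; rewrite Cnorm_mul.
  replace (Cnorm (Copp C1)) with 1.
  + rewrite Rmult_1_l; apply Rplus_le_compat; apply HB.
  + unfold Cnorm; simpl; rewrite <- sqrt_1 at 1; f_equal; ring.
Qed.

Lemma Cnorm_dcoef (a : nat -> Cplx) (n : nat) :
  Cnorm (dcoef a n) = PS_derive (fun k => Cnorm (a k)) n.
Proof.
unfold dcoef, PS_derive; rewrite Cnorm_mul, Cnorm_RtoC, Rabs_pos_eq; [reflexivity|].
apply pos_INR.
Qed.

Lemma dcoef_radius (a : nat -> Cplx) : radius_ge_1 a -> radius_ge_1 (dcoef a).
Proof.
unfold radius_ge_1; intros Ha.
rewrite (CV_radius_ext _ _ (Cnorm_dcoef a)), CV_radius_derive; exact Ha.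
Qed.

Lemma radius_ex_series (a : nat -> Cplx) (r : R) :
  radius_ge_1 a -> 0 <= r < 1 -> ex_series (fun n => Cnorm (a n) * r ^ n).
Proof.
intros Ha Hr; apply ex_series_Rabs, CV_disk_inside.
rewrite Rabs_pos_eq by lra; eapply Rbar_lt_le_trans; [|exact Ha]; simpl; lra.
Qed.

Lemma radius_conv_on_D (a : nat -> Cplx) : radius_ge_1 a -> conv_on_D a.
Proof.
intros Ha z Hz.
assert (Hr : 0 <= Cnorm z < 1) by (split; [apply Cnorm_ge0 | exact Hz]).
pose proof (radius_ex_series a _ Ha Hr) as Hs.
assert (Hterm : forall n, Cnorm (Cmul (a n) (Cpow z n)) = Cnorm (a n) * Cnorm z ^ n)
  by (intros n; rewrite Cnorm_mul, Cnorm_pow; reflexivity).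
assert (H1 : ex_series (fun n => fst (Cmul (a n) (Cpow z n)))).
{ apply (ex_series_le (K := R_AbsRing) (V := R_CompleteNormedModule)) with (2 := Hs).
  intros n; rewrite <- Hterm; apply Rabs_fst_le. }
assert (H2 : ex_series (fun n => snd (Cmul (a n) (Cpow z n)))).
{ apply (ex_series_le (K := R_AbsRing) (V := R_CompleteNormedModule)) with (2 := Hs).
  intros n; rewrite <- Hterm; apply Rabs_snd_le. }
destruct H1 as [l1 H1], H2 as [l2 H2]; exists (l1, l2).
apply series_conv_components; split.
- apply is_lim_seq_ext with (2 := H1); intros n.
  induction n as [|n IH]; [apply sum_O | rewrite sum_Sn, IH; reflexivity].
- apply is_lim_seq_ext with (2 := H2); intros n.
  induction n as [|n IH]; [apply sum_O | rewrite sum_Sn, IH; reflexivity].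
Qed.

(** * Second-order Taylor remainder of powers and partial sums *)

Section TaylorRemainder.

Variables (z w : Cplx) (r : R).
Hypotheses (Hz : Cnorm z <= r) (Hzw : Cnorm (Cadd z w) <= r).

Lemma Cpow_increment (n : nat) :
  Cnorm (Csub (Cpow (Cadd z w) (S n)) (Cpow z (S n))) <= INR (S n) * r ^ n * Cnorm w.
Proof.
pose proof (Cnorm_ge0 z) as Hz0; pose proof (Cnorm_ge0 w) as Hw0.
induction n as [|n IH].
- replace (Csub _ _) with w by (simpl; ring); simpl; lra.
- replace (Csub _ _) with (Cadd (Cmul (Cadd z w) (Csub (Cpow (Cadd z w) (S n)) (Cpow z (S n))))
    (Cmul w (Cpow z (S n)))) by (simpl; ring).
  eapply Rle_trans; [apply Cnorm_add|]; rewrite !Cnorm_mul, Cnorm_pow.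
  assert (H1 : Cnorm z ^ S n <= r ^ S n) by (apply pow_incr; lra).
  assert (H2 := Rmult_le_compat _ _ _ _ (Cnorm_ge0 _) (Cnorm_ge0 _) Hzw IH).
  assert (H3 := Rmult_le_compat_l _ _ _ Hw0 H1).
  rewrite (S_INR (S n)); simpl pow in *; lra.
Qed.

(** The remainder for the next exponent is [z] times the present remainder plus [w] times the
    increment bounded in [Cpow_increment]. The factor [INR (S (S n)) * INR (S n)] is the one that
    [dcoef (dcoef a)] puts on a coefficient. *)
Lemma Cpow_taylor (n : nat) :
  Cnorm (Csub (Csub (Cpow (Cadd z w) (S (S n))) (Cpow z (S (S n))))
    (Cmul w (Cmul (RtoC (INR (S (S n)))) (Cpow z (S n)))))
  <= INR (S (S n)) * INR (S n) * r ^ n * (Cnorm w * Cnorm w).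
Proof.
pose proof (Cnorm_ge0 z) as Hz0; pose proof (Cnorm_ge0 w) as Hw0.
induction n as [|n IH].
- replace (Csub _ _) with (Cmul w w).
  + rewrite Cnorm_mul; simpl; nra.
  + replace (RtoC (INR 2)) with (Cadd C1 C1)
      by (unfold Cadd, C1, RtoC; simpl; f_equal; ring).
    simpl; ring.
- replace (RtoC (INR (S (S (S n))))) with (Cadd C1 (RtoC (INR (S (S n)))))
    by (unfold Cadd, C1, RtoC; rewrite (S_INR (S (S n))); cbn; f_equal; ring).
  set (c := RtoC (INR (S (S n)))) in *.
  replace (Csub _ _) with (Cadd
    (Cmul z (Csub (Csub (Cpow (Cadd z w) (S (S n))) (Cpow z (S (S n)))) (Cmul w (Cmul c (Cpow z (S n))))))
    (Cmul w (Csub (Cpow (Cadd z w) (S (S n))) (Cpow z (S (S n)))))) by (simpl; ring).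
  eapply Rle_trans; [apply Cnorm_add|]; rewrite !Cnorm_mul.
  assert (H1 := Rmult_le_compat _ _ _ _ Hz0 (Cnorm_ge0 _) Hz IH).
  assert (H2 := Rmult_le_compat_l _ _ _ Hw0 (Cpow_increment (S n))).
  eapply Rle_trans; [apply Rplus_le_compat; [exact H1|exact H2]|].
  assert (Hr : 0 <= r ^ S n) by (apply pow_le; lra).
  assert (Hn : 0 <= INR (S (S n))) by apply pos_INR.
  rewrite (S_INR (S (S n))), (S_INR (S n)) in *; simpl pow in *.
  assert (0 <= (INR (S n) + 1) * (r * r ^ n) * (Cnorm w * Cnorm w))
    by (apply Rmult_le_pos; [apply Rmult_le_pos; assumption | nra]).
  lra.
Qed.

(** The truncations are staggered, [n + 2], [n + 1] and [n], because each differentiation lowers the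
    degree by one. The sum on the right stays bounded in [n] when [r < 1] and the radius is at least
    1. *)
Lemma psum_taylor (a : nat -> Cplx) (n : nat) :
  Cnorm (Csub (Csub (psum a (Cadd z w) (S (S n))) (psum a z (S (S n))))
    (Cmul w (psum (dcoef a) z (S n))))
  <= Cnorm w * Cnorm w * sum_n (fun k => Cnorm (dcoef (dcoef a) k) * r ^ k) n.
Proof.
assert (Hterm : forall k,
  Cnorm (Cmul (a (S (S k))) (Csub (Csub (Cpow (Cadd z w) (S (S k))) (Cpow z (S (S k))))
    (Cmul w (Cmul (RtoC (INR (S (S k)))) (Cpow z (S k))))))
  <= Cnorm w * Cnorm w * (Cnorm (dcoef (dcoef a) k) * r ^ k)).
{ intros k; rewrite Cnorm_mul.
  eapply Rle_trans; [apply Rmult_le_compat_l; [apply Cnorm_ge0 | apply Cpow_taylor]|].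
  rewrite !Cnorm_dcoef; unfold PS_derive; rewrite Cnorm_dcoef; unfold PS_derive.
  right; ring. }
induction n as [|n IH].
- rewrite sum_O; eapply Rle_trans; [|apply (Hterm O)].
  right; f_equal; cbn [psum Cpow]; unfold dcoef.
  change (RtoC (INR 1)) with C1; ring.
- rewrite sum_Sn; unfold plus; simpl (AbelianMonoid.plus _ _ _).
  replace (Csub _ _) with (Cadd (Csub (Csub (psum a (Cadd z w) (S (S n))) (psum a z (S (S n))))
      (Cmul w (psum (dcoef a) z (S n))))
    (Cmul (a (S (S (S n)))) (Csub (Csub (Cpow (Cadd z w) (S (S (S n)))) (Cpow z (S (S (S n)))))
    (Cmul w (Cmul (RtoC (INR (S (S (S n))))) (Cpow z (S (S n)))))))).
  + eapply Rle_trans; [apply Cnorm_add|].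
    eapply Rle_trans; [apply Rplus_le_compat; [apply IH | apply Hterm]|].
    right; symmetry; apply Rmult_plus_distr_l.
  + cbn [psum]; change (dcoef a (S (S n))) with (Cmul (RtoC (INR (S (S (S n))))) (a (S (S (S n))))); ring.
Qed.

End TaylorRemainder.

(** * The real scalar product and segments in the disc *)

Definition dot (z w : Cplx) : R := fst z * fst w + snd z * snd w.

Lemma inD_dot (z : Cplx) : inD z <-> dot z z < 1.
Proof.
unfold inD, Cnorm, dot; rewrite <- sqrt_1 at 1; split.
- intros H; apply sqrt_lt_0_alt in H; exact H.
- intros H; apply sqrt_lt_1_alt; split; [nra | exact H].
Qed.

Lemma le_of_sqr_le (t s : R) : 0 <= s -> t * t <= s * s -> t <= s.
Proof. intros Hs H; destruct (Rle_lt_dec t s); [assumption | nra]. Qed.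

Lemma dot_Cauchy_Schwarz (z w : Cplx) : dot z w * dot z w <= dot z z * dot w w.
Proof.
unfold dot.
pose proof (Rle_0_sqr (fst z * snd w - snd z * fst w)); unfold Rsqr in *; nra.
Qed.

Definition ray (z d : Cplx) (s : R) : Cplx := Cadd z (Cmul (RtoC s) d).

Definition segment (z w : Cplx) (s : R) : Cplx := ray z (Csub w z) s.

Lemma dot_segment (z w : Cplx) (s : R) :
  dot (segment z w s) (segment z w s)
  = (1 - s) * (1 - s) * dot z z + s * s * dot w w + 2 * (s * (1 - s)) * dot z w.
Proof. unfold segment, ray, dot; simpl; ring. Qed.

Lemma dot_le_mean (z w : Cplx) : 2 * dot z w <= dot z z + dot w w.
Proof.
unfold dot; pose proof (Rle_0_sqr (fst z - fst w)); pose proof (Rle_0_sqr (snd z - snd w)).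
unfold Rsqr in *; lra.
Qed.

Lemma segment_closed_disc (z w : Cplx) (s : R) :
  0 <= s <= 1 -> dot z z <= 1 -> dot w w <= 1 -> dot (segment z w s) (segment z w s) <= 1.
Proof.
intros Hs Hz Hw; rewrite dot_segment; pose proof (dot_le_mean z w).
assert (0 <= s * (1 - s)) by nra.
assert (s * (1 - s) * (2 * dot z w) <= s * (1 - s) * 2) by (apply Rmult_le_compat_l; lra).
nra.
Qed.

Lemma segment_open_disc (z w : Cplx) (s : R) :
  0 <= s < 1 -> dot z z < 1 -> dot w w <= 1 -> dot (segment z w s) (segment z w s) < 1.
Proof.
intros Hs Hz Hw; rewrite dot_segment; pose proof (dot_le_mean z w).
assert (0 <= s * (1 - s)) by nra.
assert (s * (1 - s) * (2 * dot z w) <= s * (1 - s) * 2) by (apply Rmult_le_compat_l; lra).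
assert ((1 - s) * (1 - s) * dot z z < (1 - s) * (1 - s) * 1)
  by (apply Rmult_lt_compat_l; nra).
nra.
Qed.


(** * Differentiability of power series along rays *)

Lemma pfun_taylor (a : nat -> Cplx) (r : R) :
  radius_ge_1 a -> 0 <= r < 1 ->
  exists K, 0 <= K /\ forall z w, Cnorm z <= r -> Cnorm (Cadd z w) <= r ->
    Cnorm (Csub (Csub (pfun a (Cadd z w)) (pfun a z)) (Cmul w (pder a z)))
    <= K * (Cnorm w * Cnorm w).
Proof.
intros Ha Hr.
assert (Ha1 := dcoef_radius _ Ha); assert (Ha2 := dcoef_radius _ Ha1).
(* [K] is the sum at [r] of the majorant of the second derived series, so it is uniform in [z] and
   [w]. *)
destruct (radius_ex_series _ r Ha2 Hr) as [K HK].
assert (HKle : forall n, sum_n (fun k => Cnorm (dcoef (dcoef a) k) * r ^ k) n <= K).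
{ apply is_lim_seq_incr_compare; [exact HK|]; intros n; rewrite sum_Sn.
  assert (0 <= Cnorm (dcoef (dcoef a) (S n)) * r ^ S n)
    by (apply Rmult_le_pos; [apply Cnorm_ge0 | apply pow_le; lra]).
  unfold plus; simpl in *; lra. }
exists K; split.
{ eapply Rle_trans; [|apply (HKle O)]; rewrite sum_O.
  apply Rmult_le_pos; [apply Cnorm_ge0 | apply pow_le; lra]. }
intros z w Hz Hzw.
assert (D1 : inD z) by (unfold inD; lra); assert (D2 : inD (Cadd z w)) by (unfold inD; lra).
destruct (proj1 (series_conv_components _ _ _) (series_sum_conv _ _ (radius_conv_on_D _ Ha) D2))
  as [A1 A2].
destruct (proj1 (series_conv_components _ _ _) (series_sum_conv _ _ (radius_conv_on_D _ Ha) D1))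
  as [B1 B2].
destruct (proj1 (series_conv_components _ _ _) (series_sum_conv _ _ (radius_conv_on_D _ Ha1) D1))
  as [E1 E2].
(* The limits are shifted to match the staggered truncations of [psum_taylor]. *)
apply is_lim_seq_incr_1, is_lim_seq_incr_1 in A1.
apply is_lim_seq_incr_1, is_lim_seq_incr_1 in A2.
apply is_lim_seq_incr_1, is_lim_seq_incr_1 in B1.
apply is_lim_seq_incr_1, is_lim_seq_incr_1 in B2.
apply is_lim_seq_incr_1 in E1; apply is_lim_seq_incr_1 in E2.
apply (Cnorm_lim_le (fun n => Csub (Csub (psum a (Cadd z w) (S (S n))) (psum a z (S (S n))))
  (Cmul w (psum (dcoef a) z (S n))))).
- unfold Csub; simpl.
  apply is_lim_seq_plus'; [apply is_lim_seq_plus'; [exact A1|]|].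
  + apply (proj1 (is_lim_seq_opp _ (Finite _)) B1).
  + apply (proj1 (is_lim_seq_opp _ (Finite _))), is_lim_seq_minus'.
    * apply (is_lim_seq_scal_l _ (fst w) _ E1).
    * apply (is_lim_seq_scal_l _ (snd w) _ E2).
- unfold Csub; simpl.
  apply is_lim_seq_plus'; [apply is_lim_seq_plus'; [exact A2|]|].
  + apply (proj1 (is_lim_seq_opp _ (Finite _)) B2).
  + apply (proj1 (is_lim_seq_opp _ (Finite _))), is_lim_seq_plus'.
    * apply (is_lim_seq_scal_l _ (fst w) _ E2).
    * apply (is_lim_seq_scal_l _ (snd w) _ E1).
- intros n; eapply Rle_trans; [apply (psum_taylor _ _ r); assumption|].
  rewrite Rmult_comm; apply Rmult_le_compat_r; [|apply HKle].
  apply Rmult_le_pos; apply Cnorm_ge0.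
Qed.

Lemma ray_shift (z d : Cplx) (s t : R) : ray z d (t + s) = Cadd (ray z d t) (Cmul (RtoC s) d).
Proof. unfold ray, Cadd, Cmul, RtoC; simpl; f_equal; ring. Qed.

(** The factor [c] ranges over the real linear functionals of the form [Re (c .)]: it will be 1, the
    unit number [e], or a direction and its conjugate. The quadratic remainder, divided by the
    increment, tends to 0. *)
Lemma pfun_derive_ray (a : nat -> Cplx) (c z d : Cplx) (t : R) :
  radius_ge_1 a -> inD (ray z d t) ->
  derivable_pt_lim (fun s => Cre (Cmul c (pfun a (ray z d s)))) t
    (Cre (Cmul c (Cmul d (pder a (ray z d t))))).
Proof.
intros Ha Ht eps Heps; set (p := ray z d t) in *.
assert (Hp := Cnorm_ge0 p); unfold inD in Ht.
set (r := (1 + Cnorm p) / 2).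
destruct (pfun_taylor a r Ha ltac:(unfold r; lra)) as [K [HK HT]].
assert (Hd := Cnorm_ge0 d); assert (Hc := Cnorm_ge0 c).
set (M := Cnorm c * (K * (Cnorm d * Cnorm d))).
assert (HM : 0 <= M) by (unfold M; repeat apply Rmult_le_pos; assumption).
(* The first bound keeps the moved point in the disc of radius [r], where the Taylor estimate holds;
   the second makes the remainder quotient, at most [M * Rabs s], smaller than [eps]. *)
assert (Hdel : 0 < Rmin ((r - Cnorm p) / (Cnorm d + 1)) (eps / (M + 1))).
{ apply Rmin_glb_lt; apply Rdiv_lt_0_compat; unfold r; lra. }
exists (mkposreal _ Hdel); simpl; intros s Hs0 Hs.
assert (Hs1 : Rabs s * (Cnorm d + 1) < r - Cnorm p).
{ apply Rlt_div_r; [lra|]; eapply Rlt_le_trans; [exact Hs | apply Rmin_l]. }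
assert (Hs2 : Rabs s * (M + 1) < eps).
{ apply Rlt_div_r; [lra|]; eapply Rlt_le_trans; [exact Hs | apply Rmin_r]. }
assert (Has := Rabs_pos_lt _ Hs0).
assert (Hin : Cnorm (Cadd p (Cmul (RtoC s) d)) <= r).
{ eapply Rle_trans; [apply Cnorm_add|]; rewrite Cnorm_mul, Cnorm_RtoC; nra. }
assert (HT' := HT p (Cmul (RtoC s) d) ltac:(unfold r; lra) Hin).
rewrite ray_shift; fold p.
set (rem := Csub (Csub _ _) _) in HT'.
match goal with |- Rabs ?X < _ => replace X with (Cre (Cmul c rem) / s) end.
2: { unfold rem; generalize (pfun a (Cadd p (Cmul (RtoC s) d))), (pfun a p), (pder a p).
  intros u v x; unfold Cre, Csub, Cadd, Cmul, Copp, RtoC; simpl; field; exact Hs0. }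
unfold Rdiv; rewrite Rabs_mult, Rabs_inv.
apply Rmult_lt_reg_r with (Rabs s); [exact Has|].
rewrite Rmult_assoc, Rinv_l, Rmult_1_r by lra.
eapply Rle_lt_trans; [apply (Rabs_fst_le (Cmul c rem))|]; rewrite Cnorm_mul.
rewrite Cnorm_mul, Cnorm_RtoC in HT'.
assert (H1 := Rmult_le_compat_l _ _ _ Hc HT').
assert (H2 : M * (Rabs s * (Rabs s * 1))
  = Cnorm c * (K * (Rabs s * Cnorm d * (Rabs s * Cnorm d)))) by (unfold M; ring).
nra.
Qed.

(** * Positivity of the rotated derivative and strict monotonicity of the harmonic map *)

Lemma inD_mono (z w : Cplx) : inD w -> Cnorm z <= Cnorm w -> inD z.
Proof. unfold inD; lra. Qed.

Lemma Cnorm_C0 : Cnorm C0 = 0.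
Proof. change C0 with (RtoC 0); rewrite Cnorm_RtoC; apply Rabs_R0. Qed.

Lemma pfun_C0 (a : nat -> Cplx) : conv_on_D a -> pfun a C0 = a O.
Proof.
intros Ha.
assert (H0 : inD C0) by (unfold inD; rewrite Cnorm_C0; lra).
assert (Hs : forall n, psum a C0 n = a O).
{ induction n as [|n IH]; [simpl; ring|].
  change (psum a C0 (S n)) with
    (Cadd (psum a C0 n) (Cmul (a (S n)) (Cmul C0 (Cpow C0 n)))).
  rewrite IH; ring. }
destruct (proj1 (series_conv_components _ _ _) (series_sum_conv _ _ Ha H0)) as [L1 L2].
apply is_lim_seq_unique in L1; apply is_lim_seq_unique in L2.
rewrite (Lim_seq_ext _ (fun _ => fst (a O))), Lim_seq_const in L1 by (intros n; rewrite Hs; auto).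
rewrite (Lim_seq_ext _ (fun _ => snd (a O))), Lim_seq_const in L2 by (intros n; rewrite Hs; auto).
injection L1 as L1; injection L2 as L2.
destruct (pfun a C0), (a O); simpl in *; congruence.
Qed.

(* Where [q] attains its minimum over [[0, 1]] its derivative is nonpositive, unless the minimum
   is at [0]; there the differential inequality makes [q] positive. *)
Lemma ode_positive (q q' : R -> R) (alpha : R) :
  0 <= alpha -> (forall s, 0 <= s <= 1 -> derivable_pt_lim q s (q' s)) -> 0 < q 0 ->
  (forall s, 0 <= s <= 1 -> 0 < q s + alpha * (s * q' s)) -> 0 < q 1.
Proof.
intros Halpha Hder H0 Hode.
destruct (continuity_ab_min q 0 1) as [m [Hmin Hm]]; [lra| |].
{ intros c Hc; apply derivable_continuous_pt; exists (q' c); apply Hder, Hc. }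
apply Rlt_le_trans with (q m); [|apply Hmin; lra].
destruct (Req_dec m 0) as [->|Hm0]; [exact H0|].
assert (Hq' : q' m <= 0).
{ destruct (Rle_lt_dec (q' m) 0) as [H|H]; [exact H|exfalso].
  destruct (Hder m Hm (q' m) H) as [del Hdel].
  set (h := - Rmin (del / 2) m).
  assert (Hpos : 0 < Rmin (del / 2) m)
    by (apply Rmin_glb_lt; [destruct del; simpl; lra | lra]).
  assert (Rmin (del / 2) m <= del / 2) by apply Rmin_l.
  assert (Rmin (del / 2) m <= m) by apply Rmin_r.
  assert (Hh : Rabs h < del).
  { unfold h; rewrite Rabs_Ropp, Rabs_pos_eq by lra; destruct del; simpl in *; lra. }
  specialize (Hdel h ltac:(unfold h; lra) Hh).
  assert (Hle := Hmin (m + h) ltac:(unfold h; lra)).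
  apply Rabs_def2 in Hdel; destruct Hdel as [_ Hdel].
  assert (Hneg : (q (m + h) - q m) / h <= 0).
  { unfold Rdiv; rewrite <- (Rmult_0_r (q (m + h) - q m)).
    apply Rmult_le_compat_l; [lra|]; left; apply Rinv_lt_0_compat; unfold h; lra. }
  lra. }
specialize (Hode m Hm).
assert (0 <= alpha * (m * - q' m))
  by (apply Rmult_le_pos; [lra | apply Rmult_le_pos; lra]).
nra.
Qed.

Lemma ray_C0 (z : Cplx) (s : R) : ray C0 z s = Cmul (RtoC s) z.
Proof. unfold ray; ring. Qed.

Lemma WH0_rotation_positive (alpha beta : R) (a b : nat -> Cplx) (e z : Cplx) :
  alpha >= 0 -> 0 <= beta -> in_WH0 alpha beta a b -> Cnorm e = 1 -> inD z ->
  0 < Cre (pder a z) + Cre (Cmul e (pder b z)).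
Proof.
intros Halpha Hbeta [[_ [Ha1 [_ [Hb1 [Ha Hb]]]]] Hineq] He Hz.
assert (Ra := dcoef_radius _ (conv_on_D_radius _ Ha)).
assert (Rb := dcoef_radius _ (conv_on_D_radius _ Hb)).
set (q := fun s => Cre (Cmul C1 (pder a (ray C0 z s))) + Cre (Cmul e (pder b (ray C0 z s)))).
set (q' := fun s => Cre (Cmul C1 (Cmul z (pder2 a (ray C0 z s))))
  + Cre (Cmul e (Cmul z (pder2 b (ray C0 z s))))).
assert (Hray : forall s, 0 <= s <= 1 -> inD (ray C0 z s)).
{ intros s Hs; apply inD_mono with z; [exact Hz|].
  rewrite ray_C0, Cnorm_mul, Cnorm_RtoC, Rabs_pos_eq by lra.
  pose proof (Cnorm_ge0 z); nra. }
assert (Hq1 : q 1 = Cre (pder a z) + Cre (Cmul e (pder b z))).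
{ unfold q; replace (ray C0 z 1) with z by (rewrite ray_C0; change (RtoC 1) with C1; ring).
  f_equal; f_equal; ring. }
rewrite <- Hq1; apply ode_positive with q' alpha; [lra| | |].
- intros s Hs; unfold q, q'; apply (derivable_pt_lim_plus
    (fun s => Cre (Cmul C1 (pder a (ray C0 z s)))) (fun s => Cre (Cmul e (pder b (ray C0 z s)))));
    apply pfun_derive_ray; auto.
(* At the origin only the first-order coefficients remain, and [a 1 = 1], [b 1 = 0] give
   [q 0 = 1]. *)
- unfold q; replace (ray C0 z 0) with C0 by (rewrite ray_C0; change (RtoC 0) with C0; ring).
  unfold pder; rewrite !pfun_C0 by (apply radius_conv_on_D; assumption).
  unfold dcoef; rewrite Ha1, Hb1; simpl; lra.
- intros s Hs; specialize (Hineq _ (Hray s Hs)); unfold q, q'.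
  set (P := ray C0 z s) in *.
  assert (HP : P = Cmul (RtoC s) z) by apply ray_C0; clearbody P.
  set (A1 := pder a P) in *; set (A2 := pder2 a P) in *.
  set (B1 := pder b P) in *; set (B2 := pder2 b P) in *.
  clearbody A1 A2 B1 B2; rewrite HP in Hineq.
  set (B := Cadd B1 _) in Hineq.
  (* As [e] has norm 1, the defining inequality of the class dominates [- Re (e B)]; discarding
     [beta >= 0] leaves the differential inequality for [q]. *)
  assert (HeB : - Cre (Cmul e B) <= Cnorm B).
  { pose proof (Rabs_fst_le (Cmul e B)) as H; rewrite Cnorm_mul, He in H.
    apply Rabs_le_between in H; unfold Cre; lra. }
  apply Rlt_le_trans with (Cre (Csub (Cadd A1 (Cmul (RtoC alpha)
    (Cmul (Cmul (RtoC s) z) A2))) (RtoC beta)) + Cre (Cmul e B)); [lra|].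
  unfold B, Cre, Csub, Copp, Cadd, Cmul, RtoC, C1; simpl; lra.
Qed.

(** The scalar product of [u] with the conjugate of [g] is [Re (u g)], so both summands are real
    parts of analytic functions times constants. *)
Lemma harm_derive_ray (a b : nat -> Cplx) (z d u : Cplx) (t : R) :
  conv_on_D a -> conv_on_D b -> inD (ray z d t) ->
  derivable_pt_lim (fun s => dot (harm a b (ray z d s)) u) t
    (Cre (Cmul (Cconj u) (Cmul d (pder a (ray z d t))))
     + Cre (Cmul u (Cmul d (pder b (ray z d t))))).
Proof.
intros Ha Hb Ht.
apply derivable_pt_lim_ext with (fun s => Cre (Cmul (Cconj u) (pfun a (ray z d s)))
  + Cre (Cmul u (pfun b (ray z d s)))).
{ intros s; unfold dot, harm, Cre, Cadd, Cmul, Cconj; simpl; ring. }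
apply (derivable_pt_lim_plus (fun s => Cre (Cmul (Cconj u) (pfun a (ray z d s))))
  (fun s => Cre (Cmul u (pfun b (ray z d s)))));
  apply pfun_derive_ray; auto using conv_on_D_radius.
Qed.

Lemma dot_gt0 (d : Cplx) : d <> C0 -> 0 < dot d d.
Proof.
intros Hd; destruct d as [x y]; unfold dot; simpl.
destruct (Req_dec x 0) as [->|Hx]; [destruct (Req_dec y 0) as [->|Hy]|].
- contradiction Hd; reflexivity.
- nra.
- nra.
Qed.

Definition strictly_monotone_on_D (f : Cplx -> Cplx) : Prop :=
  forall z1 z2, inD z1 -> inD z2 -> z1 <> z2 -> 0 < dot (Csub (f z2) (f z1)) (Csub z2 z1).

(* With [d = z2 - z1], the derivative of [s => dot (f (z1 + s d)) d] is
   [|d|^2 Re (h' + e g')] for the unit number [e = d^2 / |d|^2]. *)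
Lemma WH0_strictly_monotone (alpha beta : R) (a b : nat -> Cplx) :
  alpha >= 0 -> 0 <= beta -> in_WH0 alpha beta a b -> strictly_monotone_on_D (harm a b).
Proof.
intros Halpha Hbeta HW z1 z2 H1 H2 Hne.
destruct (HW) as [[_ [_ [_ [_ [Ha Hb]]]]] _].
set (d := Csub z2 z1).
assert (Hd : 0 < dot d d).
{ apply dot_gt0; intros E; apply Hne.
  replace z2 with (Cadd z1 d) by (unfold d; ring); rewrite E; ring. }
assert (Hray : forall s, 0 <= s <= 1 -> inD (ray z1 d s)).
{ intros s Hs; apply inD_dot in H1; apply inD_dot in H2; apply inD_dot.
  destruct (Rle_lt_or_eq_dec s 1 (proj2 Hs)) as [Hs1| ->].
  - apply segment_open_disc; lra.
  - replace (ray z1 d 1) with z2; [exact H2|].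
    unfold ray, d; change (RtoC 1) with C1; ring. }
destruct (MVT_cor2 (fun s => dot (harm a b (ray z1 d s)) d) _ 0 1 Rlt_0_1
  (fun s Hs => harm_derive_ray a b z1 d d s Ha Hb (Hray s Hs))) as [s [Hs Hs01]].
replace (ray z1 d 1) with z2 in Hs by (unfold ray, d; change (RtoC 1) with C1; ring).
replace (ray z1 d 0) with z1 in Hs by (unfold ray, d; change (RtoC 0) with C0; ring).
set (e := Cmul (RtoC (/ dot d d)) (Cmul d d)).
assert (He : Cnorm e = 1).
{ unfold e; rewrite !Cnorm_mul, Cnorm_RtoC, Rabs_pos_eq by (left; apply Rinv_0_lt_compat, Hd).
  unfold Cnorm; rewrite sqrt_sqrt by (unfold dot in Hd; lra).
  apply Rinv_l; unfold dot in *; lra. }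
assert (Hpos := WH0_rotation_positive alpha beta a b e (ray z1 d s) Halpha Hbeta HW He
  (Hray s ltac:(lra))).
replace (dot (Csub _ _) d) with (dot (harm a b z2) d - dot (harm a b z1) d)
  by (unfold dot, Csub, Cadd, Copp; simpl; ring).
rewrite Hs; set (P := ray z1 d s) in *.
replace (_ * (1 - 0)) with (dot d d * (Cre (pder a P) + Cre (Cmul e (pder b P)))).
- apply Rmult_lt_0_compat; assumption.
- unfold e; clear -Hd; destruct (pder a P), (pder b P), d.
  unfold dot, Cre, Cmul, Cconj, RtoC in *; simpl in *; field; lra.
Qed.

(** * Approximate solution of finitely many monotone inequalities *)

Definition lsum {A : Type} (F : A -> R) (l : list A) : R :=
  fold_right (fun x s => F x + s) 0 l.

Lemma lsum_le {A : Type} (F G : A -> R) (l : list A) :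
  (forall x, In x l -> F x <= G x) -> lsum F l <= lsum G l.
Proof.
induction l as [|x l IH]; simpl; intros H; [lra|].
apply Rplus_le_compat; auto.
Qed.

Lemma lsum_ge0 {A : Type} (F : A -> R) (l : list A) :
  (forall x, 0 <= F x) -> 0 <= lsum F l.
Proof.
intros H; induction l as [|x l IH]; simpl; [lra|].
apply Rplus_le_le_0_compat; auto.
Qed.

Lemma lsum_member_le {A : Type} (F : A -> R) (l : list A) (x : A) :
  (forall x, 0 <= F x) -> In x l -> F x <= lsum F l.
Proof.
intros H; induction l as [|y l IH]; simpl; intros Hx; [tauto|].
pose proof (lsum_ge0 F l H); pose proof (H y).
destruct Hx as [-> | Hx]; [lra|].
pose proof (IH Hx); lra.
Qed.

Lemma lsum_plus {A : Type} (F G : A -> R) (l : list A) :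
  lsum (fun x => F x + G x) l = lsum F l + lsum G l.
Proof. induction l as [|x l IH]; simpl; [|rewrite IH]; ring. Qed.

Lemma lsum_scal {A : Type} (c : R) (F : A -> R) (l : list A) :
  lsum (fun x => c * F x) l = c * lsum F l.
Proof. induction l as [|x l IH]; simpl; [|rewrite IH]; ring. Qed.

Lemma lsum_ext {A : Type} (F G : A -> R) (l : list A) :
  (forall x, F x = G x) -> lsum F l = lsum G l.
Proof. intros H; induction l as [|x l IH]; simpl; [|rewrite IH, H]; reflexivity. Qed.

(** A finite piece of the graph of a monotone map: each pair consists of a point and the value
    there. *)
Definition monotone_list (l : list (Cplx * Cplx)) : Prop :=
  forall p q, In p l -> In q l -> 0 <= dot (Csub (snd p) (snd q)) (Csub (fst p) (fst q)).

Definition wsum (lam : Cplx * Cplx -> R) (F : Cplx * Cplx -> Cplx) (l : list (Cplx * Cplx)) : Cplx :=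
  (lsum (fun p => lam p * fst (F p)) l, lsum (fun p => lam p * snd (F p)) l).

(** Twice the difference of the two sides is the double sum of [lam p * lam q] times the
    monotonicity products of [p] and [q], all nonnegative. The induction adds the cross terms of one
    new pair at a time. *)
Lemma wsum_monotone (lam : Cplx * Cplx -> R) (l : list (Cplx * Cplx)) :
  (forall p, 0 <= lam p) -> monotone_list l ->
  dot (wsum lam snd l) (wsum lam fst l)
  <= lsum lam l * lsum (fun p => lam p * dot (snd p) (fst p)) l.
Proof.
intros Hlam; induction l as [|q l IH]; intros Hl; [unfold dot; simpl; lra|].
assert (IH' := IH (fun p r Hp Hr => Hl p r (or_intror Hp) (or_intror Hr))); clear IH.
assert (Hq : 0 <= lsum (fun p => lam p * dot (Csub (snd p) (snd q)) (Csub (fst p) (fst q))) l).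
{ rewrite <- (Rmult_0_l (lsum (fun _ : Cplx * Cplx => 0) l)), <- lsum_scal.
  apply lsum_le; intros p Hp; rewrite Rmult_0_l.
  apply Rmult_le_pos; [auto|]; apply Hl; simpl; auto. }
assert (E : lsum (fun p => lam p * dot (Csub (snd p) (snd q)) (Csub (fst p) (fst q))) l
  = lsum (fun p => lam p * dot (snd p) (fst p)) l + dot (snd q) (fst q) * lsum lam l
    + (- dot (wsum lam snd l) (fst q) + - dot (snd q) (wsum lam fst l))).
{ clear; induction l as [|p l IH]; [unfold dot; simpl; ring|].
  cbn [lsum fold_right] in *; fold (lsum (A := Cplx * Cplx)) in *.
  unfold lsum in IH; rewrite IH; unfold wsum, dot, lsum; simpl; ring. }
rewrite E in Hq.
unfold wsum, dot, lsum in *; cbn in *.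
pose proof (Hlam q) as Hlq.
pose proof (Rmult_le_pos _ _ Hlq Hq).
nra.
Qed.

(** The violation at [x] of the inequality [<y, x - z> <= 0] for the pair [p = (z, y)]. The sum of
    the squares, [penalty], is differentiable in [x] and vanishes exactly when all the inequalities
    hold. *)
Definition excess (x : Cplx) (p : Cplx * Cplx) : R := Rmax 0 (dot (snd p) (Csub x (fst p))).

Definition penalty (l : list (Cplx * Cplx)) (x : Cplx) : R :=
  lsum (fun p => excess x p * excess x p) l.

Lemma excess_ge0 (x : Cplx) (p : Cplx * Cplx) : 0 <= excess x p.
Proof. apply Rmax_l. Qed.

Lemma penalty_ge0 (l : list (Cplx * Cplx)) (x : Cplx) : 0 <= penalty l x.
Proof. apply lsum_ge0; intros p; pose proof (excess_ge0 x p); nra. Qed.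

(** Convexity of the closed disc, in a form without division: once the total weight is positive, the
    barycentre lies in the disc. *)
Lemma wsum_closed_disc (lam : Cplx * Cplx -> R) (l : list (Cplx * Cplx)) :
  (forall p, 0 <= lam p) -> (forall p, In p l -> dot (fst p) (fst p) <= 1) ->
  dot (wsum lam fst l) (wsum lam fst l) <= lsum lam l * lsum lam l.
Proof.
intros Hlam; induction l as [|q l IH]; intros Hl; [unfold dot; simpl; lra|].
assert (IH' := IH (fun p Hp => Hl p (or_intror Hp))); clear IH.
assert (Hq := Hl q (or_introl eq_refl)).
assert (HS := lsum_ge0 lam l Hlam); assert (Hlq := Hlam q).
set (X := wsum lam fst l) in *; set (S := lsum lam l) in *.
assert (HX : dot X (fst q) <= S).
{ apply le_of_sqr_le; [exact HS|].
  eapply Rle_trans; [apply dot_Cauchy_Schwarz|].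
  rewrite <- (Rmult_1_r (S * S)); apply Rmult_le_compat; unfold dot in *; nra. }
replace (dot (wsum lam fst (q :: l)) (wsum lam fst (q :: l)))
  with (dot X X + 2 * lam q * dot X (fst q) + lam q * lam q * dot (fst q) (fst q))
  by (unfold X, wsum, dot; simpl; ring).
change (lsum lam (q :: l)) with (lam q + S).
assert (lam q * dot X (fst q) <= lam q * S) by (apply Rmult_le_compat_l; assumption).
assert (lam q * lam q * dot (fst q) (fst q) <= lam q * lam q * 1)
  by (apply Rmult_le_compat_l; nra).
lra.
Qed.

(** First-order expansion of the squared positive part, whose derivative is twice the positive part,
    with the error bounded by [u * u]. *)
Lemma sqr_pos_part_add (v u : R) :
  Rmax 0 (v + u) * Rmax 0 (v + u) <= Rmax 0 v * Rmax 0 v + 2 * u * Rmax 0 v + u * u.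
Proof. unfold Rmax; repeat destruct Rle_dec; nra. Qed.

Lemma pos_part_mult (v : R) : Rmax 0 v * v = Rmax 0 v * Rmax 0 v.
Proof. unfold Rmax; destruct Rle_dec; ring. Qed.

(* One descent step, towards the barycentre of the points weighted by their excesses. *)
Lemma penalty_descent (l : list (Cplx * Cplx)) (x : Cplx) (s : R) :
  monotone_list l -> (forall p, In p l -> dot (fst p) (fst p) <= 1) ->
  dot x x <= 1 -> 0 < penalty l x -> 0 <= s <= 1 ->
  exists x', dot x' x' <= 1 /\
    penalty l x' <= (1 - 2 * s) * penalty l x
                    + s * s * lsum (fun p => 4 * dot (snd p) (snd p)) l.
Proof.
intros Hmon Hl Hx Hpos Hs.
set (lam := excess x); assert (Hlam : forall p, 0 <= lam p) by apply excess_ge0.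
set (S := lsum lam l); set (X := wsum lam fst l); set (Y := wsum lam snd l).
set (A := lsum (fun p => lam p * dot (snd p) (fst p)) l).
assert (HS : 0 < S).
{ destruct (Rle_lt_or_eq_dec 0 S (lsum_ge0 lam l Hlam)) as [H|H]; [exact H|exfalso].
  apply (Rlt_irrefl 0); apply Rlt_le_trans with (1 := Hpos).
  unfold penalty; rewrite <- (Rmult_0_l (lsum (fun _ : Cplx * Cplx => 0) l)), <- lsum_scal.
  apply lsum_le; intros p Hp.
  assert (H0 := lsum_member_le lam l p Hlam Hp); fold S in H0.
  specialize (Hlam p); fold lam; replace (lam p) with 0 by lra; lra. }
set (b := Cmul (RtoC (/ S)) X).
assert (Hb : dot b b <= 1).
{ replace (dot b b) with (dot X X / (S * S))
    by (unfold b, dot, Cmul, RtoC; simpl; field; lra).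
  apply Rle_div_l; [nra|]; rewrite Rmult_1_l; apply wsum_closed_disc; assumption. }
assert (HYX : dot Y X <= S * A) by (apply wsum_monotone; assumption).
(* Half the slope of the penalty from [x] towards the barycentre [b]. Monotonicity gives
   [<Y, b> <= A], while [<Y, x> - A] is the penalty itself, because an excess times the signed
   violation is the squared excess. *)
assert (Hdir : lsum (fun p => lam p * dot (snd p) (Csub b x)) l <= - penalty l x).
{ replace (lsum _ l) with (dot Y b - dot Y x).
  - replace (penalty l x) with (dot Y x - A).
    + replace (dot Y b) with (dot Y X / S)
        by (unfold b, dot, Cmul, RtoC; simpl; field; lra).
      assert (dot Y X / S <= A) by (apply Rle_div_l; [exact HS | lra]).
      lra.
    + unfold penalty, A, Y; clear.
      transitivity (lsum (fun p => lam p * dot (snd p) (Csub x (fst p))) l).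
      * induction l as [|p l IH]; [unfold dot; simpl; ring|].
        cbn [lsum fold_right]; unfold lsum in IH; rewrite <- IH.
        unfold wsum, dot, lsum; simpl; ring.
      * apply lsum_ext; intros p; apply pos_part_mult.
  - unfold Y; clearbody b; clear; induction l as [|p l IH]; [unfold dot; simpl; ring|].
    cbn [lsum fold_right]; unfold lsum in IH; rewrite <- IH.
    unfold wsum, dot, lsum; simpl; ring. }
exists (segment x b s); split; [apply segment_closed_disc; assumption|].
assert (Hp : forall p, excess (segment x b s) p * excess (segment x b s) p
  <= lam p * lam p + 2 * s * (lam p * dot (snd p) (Csub b x))
     + s * s * (4 * dot (snd p) (snd p))).
{ intros p; unfold lam, excess.
  replace (dot (snd p) (Csub (segment x b s) (fst p)))
    with (dot (snd p) (Csub x (fst p)) + s * dot (snd p) (Csub b x))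
    by (unfold segment, ray, dot, Csub, Cadd, Copp, Cmul, RtoC; simpl; ring).
  eapply Rle_trans; [apply sqr_pos_part_add|].
  (* The closed disc has diameter 2. *)
  assert (Hbx : dot (Csub b x) (Csub b x) <= 4).
  { assert (H := dot_le_mean b (Copp x)).
    unfold dot, Csub, Cadd, Copp in *; simpl in *; lra. }
  assert (HCS := dot_Cauchy_Schwarz (snd p) (Csub b x)).
  assert (0 <= dot (snd p) (snd p)) by (unfold dot; nra).
  assert (dot (snd p) (Csub b x) * dot (snd p) (Csub b x) <= 4 * dot (snd p) (snd p)) by nra.
  assert (0 <= s * s) by nra.
  assert (s * s * (dot (snd p) (Csub b x) * dot (snd p) (Csub b x))
    <= s * s * (4 * dot (snd p) (snd p))) by (apply Rmult_le_compat_l; assumption).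
  lra. }
assert (Hsum := lsum_le _ _ l (fun p _ => Hp p)).
rewrite !lsum_plus, !lsum_scal in Hsum.
change (lsum (fun p => lam p * lam p) l) with (penalty l x) in Hsum.
rewrite !lsum_scal; unfold penalty at 1.
assert (2 * s * lsum (fun p => lam p * dot (snd p) (Csub b x)) l <= 2 * s * - penalty l x)
  by (apply Rmult_le_compat_l; lra).
lra.
Qed.

(** If the infimum [m] of the penalty over the closed disc were positive, a descent step from a
    near-minimiser would fall below [m]. Here [m] is obtained as the supremum of the set [E] of
    lower bounds. *)
Lemma penalty_small (l : list (Cplx * Cplx)) (eps : R) :
  monotone_list l -> (forall p, In p l -> dot (fst p) (fst p) <= 1) -> 0 < eps ->
  exists x, dot x x <= 1 /\ penalty l x <= eps.
Proof.
intros Hmon Hl Heps; apply NNPP; intros Hno.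
set (E := fun m => forall x, dot x x <= 1 -> m <= penalty l x).
assert (H0 : dot C0 C0 <= 1) by (unfold dot; simpl; lra).
destruct (completeness E) as [m [Hub Hlub]].
{ exists (penalty l C0); intros m Hm; apply Hm, H0. }
{ exists 0; intros x _; apply penalty_ge0. }
assert (Hm : E m) by (intros x Hx; apply Hlub; intros m' Hm'; apply Hm', Hx).
assert (Hm0 : 0 < m).
{ apply Rlt_le_trans with eps; [exact Heps|]; apply Hub; intros x Hx.
  left; apply Rnot_le_lt; intros H; apply Hno; exists x; auto. }
set (C := lsum (fun p => 4 * dot (snd p) (snd p)) l).
assert (HC : 0 <= C) by (apply lsum_ge0; intros p; unfold dot; nra).
(* The bound 1/2 keeps [1 - 2 * s] nonnegative; the other makes the quadratic error [s * s * C]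
   smaller than [s * m], which is what the step gains from a start below [m + s * m]. *)
set (s := Rmin (1 / 2) (m / (C + 1))).
assert (Hs0 : 0 < s) by (apply Rmin_glb_lt; [lra | apply Rdiv_lt_0_compat; lra]).
assert (Hs1 : s <= 1 / 2) by apply Rmin_l.
assert (Hs2 : s * (C + 1) <= m) by (apply Rle_div_r; [lra | apply Rmin_r]).
destruct (classic (exists x, dot x x <= 1 /\ penalty l x < m + s * m)) as [[x [Hx Hpx]]|Hn].
- destruct (penalty_descent l x s Hmon Hl Hx) as [x' [Hx' Hpx']]; [|lra|].
  { apply Rlt_le_trans with m; [exact Hm0 | apply Hm, Hx]. }
  assert (Hmx' := Hm x' Hx'); fold C in Hpx'.
  assert ((1 - 2 * s) * penalty l x <= (1 - 2 * s) * (m + s * m))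
    by (apply Rmult_le_compat_l; lra).
  assert (s * (s * (C + 1)) <= s * m) by (apply Rmult_le_compat_l; lra).
  assert (0 < s * s) by nra.
  assert (0 < s * s * m) by nra.
  lra.
- assert (H : E (m + s * m)).
  { intros x Hx; apply Rnot_lt_le; intros H; apply Hn; exists x; auto. }
  apply Hub in H; nra.
Qed.

Lemma finite_variational_inequality (l : list (Cplx * Cplx)) (eps : R) :
  monotone_list l -> (forall p, In p l -> dot (fst p) (fst p) <= 1) -> 0 < eps ->
  exists x, dot x x <= 1 /\ forall p, In p l -> dot (snd p) (Csub x (fst p)) <= eps.
Proof.
intros Hmon Hl Heps.
destruct (penalty_small l (eps * eps) Hmon Hl ltac:(nra)) as [x [Hx Hp]].
exists x; split; [exact Hx|]; intros p Hin.
apply Rle_trans with (excess x p); [apply Rmax_r|].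
apply le_of_sqr_le; [lra|]; apply Rle_trans with (2 := Hp).
apply (lsum_member_le (fun p => excess x p * excess x p)); [|exact Hin].
intros q; pose proof (excess_ge0 x q); nra.
Qed.

(** * Solvability in the closed disc by compactness *)

(** Only values of [f] in the open disc occur, so [zeta] may lie on the circle. Each condition is
    affine in [zeta] for fixed [w], and affine in [w] for fixed [zeta]. *)
Definition solves (f : Cplx -> Cplx) (w zeta : Cplx) : Prop :=
  forall z, inD z -> 0 <= dot (Csub w (f z)) (Csub zeta z).

(** An inequality violated at [x] remains violated, with a margin, on a small square around [x].
    Points [x] outside the closed disc are included because the compactness argument runs over a
    whole square; around them the small square misses the disc. *)
Lemma unsolved_neighbourhood (f : Cplx -> Cplx) (w : Cplx) :
  (forall zeta, dot zeta zeta <= 1 -> ~ solves f w zeta) ->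
  forall x : Cplx, exists q : posreal * Cplx, inD (snd q) /\
    forall x', Rabs (fst x' - fst x) < fst q -> Rabs (snd x' - snd x) < fst q ->
    dot x' x' <= 1 -> fst q < dot (Csub (f (snd q)) w) (Csub x' (snd q)).
Proof.
intros Hno x; destruct (Rle_lt_dec (dot x x) 1) as [Hx|Hx].
- destruct (not_all_ex_not _ _ (Hno x Hx)) as [z Hz].
  apply imply_to_and in Hz; destruct Hz as [Hz Hneg].
  set (y := Csub (f z) w).
  set (c := dot y (Csub x z)).
  assert (Hc : 0 < c).
  { apply Rnot_le_lt in Hneg; replace c with (- dot (Csub w (f z)) (Csub x z)); [lra|].
    unfold c, y, dot, Csub, Cadd, Copp; simpl; ring. }
  set (N := Rabs (fst y) + Rabs (snd y)).
  assert (HN : 0 <= N) by (apply Rplus_le_le_0_compat; apply Rabs_pos).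
  (* On the square of half-side [del] the product changes by at most [N * del], so at least
     [2 * del] of [c = (N + 2) * del] remains. *)
  assert (Hdel : 0 < c / (N + 2)) by (apply Rdiv_lt_0_compat; lra).
  exists (mkposreal _ Hdel, z); simpl; split; [exact Hz|]; intros x' H1 H2 _.
  set (del := c / (N + 2)) in *.
  assert (Hcd : c = del * (N + 2)) by (unfold del; field; lra).
  replace (dot _ _) with (c + (fst y * (fst x' - fst x) + snd y * (snd x' - snd x)))
    by (unfold c, y, dot, Csub, Cadd, Copp; simpl; ring).
  assert (B1 : Rabs (fst y * (fst x' - fst x)) <= Rabs (fst y) * del)
    by (rewrite Rabs_mult; apply Rmult_le_compat_l; [apply Rabs_pos | lra]).
  assert (B2 : Rabs (snd y * (snd x' - snd x)) <= Rabs (snd y) * del)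
    by (rewrite Rabs_mult; apply Rmult_le_compat_l; [apply Rabs_pos | lra]).
  apply Rabs_le_between in B1; apply Rabs_le_between in B2; unfold N in Hcd; nra.
- set (del := Rmin 1 ((dot x x - 1) / (2 * (Rabs (fst x) + Rabs (snd x) + 1)))).
  assert (HN : 0 <= Rabs (fst x) + Rabs (snd x))
    by (apply Rplus_le_le_0_compat; apply Rabs_pos).
  assert (Hdel : 0 < del) by (apply Rmin_glb_lt; [lra | apply Rdiv_lt_0_compat; lra]).
  (* [C0] is a dummy witness: no [x'] of the closed disc is this close to [x]. *)
  exists (mkposreal _ Hdel, C0); simpl; split.
  { apply inD_dot; unfold dot; simpl; lra. }
  intros x' H1 H2 Hx'; exfalso.
  assert (Hd : del * (2 * (Rabs (fst x) + Rabs (snd x) + 1)) <= dot x x - 1)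
    by (apply Rle_div_r; [lra | apply Rmin_r]).
  assert (B1 : Rabs (fst x * (fst x' - fst x)) <= Rabs (fst x) * del)
    by (rewrite Rabs_mult; apply Rmult_le_compat_l; [apply Rabs_pos | lra]).
  assert (B2 : Rabs (snd x * (snd x' - snd x)) <= Rabs (snd x) * del)
    by (rewrite Rabs_mult; apply Rmult_le_compat_l; [apply Rabs_pos | lra]).
  apply Rabs_le_between in B1; apply Rabs_le_between in B2.
  assert (E : dot x' x' = dot x x + 2 * (fst x * (fst x' - fst x) + snd x * (snd x' - snd x))
    + (fst x' - fst x) * (fst x' - fst x) + (snd x' - snd x) * (snd x' - snd x))
    by (unfold dot; ring).
  pose proof (Rle_0_sqr (fst x' - fst x)); pose proof (Rle_0_sqr (snd x' - snd x)).
  unfold Rsqr in *; lra.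
Qed.

Lemma list_min_pos {A : Type} (delta : A -> posreal) (l : list A) :
  exists eps, 0 < eps /\ forall t, In t l -> eps <= delta t.
Proof.
induction l as [|t l [eps [Heps H]]].
- exists 1; split; [lra | intros t []].
- exists (Rmin eps (delta t)); split.
  + apply Rmin_glb_lt; [exact Heps | apply cond_pos].
  + intros t' [<-|Ht']; [apply Rmin_r|].
    eapply Rle_trans; [apply Rmin_l | apply H, Ht'].
Qed.

(* Minty's argument: approximate solutions of finitely many of the inequalities, and compactness
   of the closed disc. *)
Lemma solvable_in_closed_disc (f : Cplx -> Cplx) (w : Cplx) :
  strictly_monotone_on_D f -> exists zeta, dot zeta zeta <= 1 /\ solves f w zeta.
Proof.
intros Hmon; apply NNPP; intros Hno.
assert (Hno' : forall zeta, dot zeta zeta <= 1 -> ~ solves f w zeta)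
  by (intros zeta H1 H2; apply Hno; exists zeta; auto).
pose (q := fun x => proj1_sig (constructive_indefinite_description _
  (unsolved_neighbourhood f w Hno' x))).
assert (Hq := fun x => proj2_sig (constructive_indefinite_description _
  (unsolved_neighbourhood f w Hno' x))).
cbv beta in Hq; change (forall x, inD (snd (q x)) /\
  forall x', Rabs (fst x' - fst x) < fst (q x) -> Rabs (snd x' - snd x) < fst (q x) ->
  dot x' x' <= 1 -> fst (q x) < dot (Csub (f (snd (q x))) w) (Csub x' (snd (q x)))) in Hq.
clearbody q.
pose (pt := fun t : Tn 2 R => (fst t, fst (snd t)) : Cplx).
(* The square [[-1, 1]^2] contains the closed disc. The finite subcover comes doubly negated, which
   suffices for the goal [False]. *)
apply (compactness_list 2 (-1, (-1, tt)) (1, (1, tt)) (fun t => fst (q (pt t)))).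
intros [l Hl].
destruct (list_min_pos (fun t => fst (q (pt t))) l) as [eps [Heps Hmin]].
destruct (finite_variational_inequality
  (map (fun t => (snd (q (pt t)), Csub (f (snd (q (pt t)))) w)) l) eps) as [x [Hx Hxl]].
- intros p1 p2 Hp1 Hp2.
  apply in_map_iff in Hp1; destruct Hp1 as [t1 [<- _]].
  apply in_map_iff in Hp2; destruct Hp2 as [t2 [<- _]]; simpl.
  destruct (classic (snd (q (pt t1)) = snd (q (pt t2)))) as [E|E].
  + rewrite E; unfold dot, Csub, Cadd, Copp; simpl; nra.
  + assert (H := Hmon _ _ (proj1 (Hq (pt t2))) (proj1 (Hq (pt t1))) (not_eq_sym E)).
    left; revert H; unfold dot, Csub, Cadd, Copp; simpl; lra.
- intros p Hp; apply in_map_iff in Hp; destruct Hp as [t [<- _]]; simpl.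
  left; apply inD_dot, Hq.
- exact Heps.
(* The approximate solution [x] lies in one of the finitely many squares, where some inequality
   fails by more than the half-side of that square, hence by more than [eps]. *)
- destruct (Hl (fst x, (snd x, tt))) as [[t1 [t2 []]] [Hin [_ [Hc1 [Hc2 _]]]]].
  { unfold dot in Hx; simpl; repeat split; nra. }
  set (t := (t1, (t2, tt)) : Tn 2 R) in *.
  assert (Hgt := proj2 (Hq (pt t)) x Hc1 Hc2 Hx).
  exact (Rlt_not_le _ _ Hgt (Rle_trans _ _ _ (Hxl _ (in_map _ _ _ Hin)) (Hmin t Hin))).
Qed.

(** * The image of a strictly monotone map and the half-lines filling its complement *)

Definition ray_continuous_on_D (f : Cplx -> Cplx) : Prop :=
  forall z u, inD z -> continuity_pt (fun s => dot (f (ray z u s)) u) 0.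

Lemma ray_0 (z u : Cplx) : ray z u 0 = z.
Proof. unfold ray; change (RtoC 0) with C0; ring. Qed.

Lemma inD_ray_near (z u : Cplx) :
  inD z -> exists del, 0 < del /\ forall s, 0 <= s < del -> inD (ray z u s).
Proof.
intros Hz; assert (Hu := Cnorm_ge0 u); unfold inD in *.
exists ((1 - Cnorm z) / (Cnorm u + 1)); split; [apply Rdiv_lt_0_compat; lra|].
intros s [Hs0 Hs]; apply Rlt_div_r in Hs; [|lra].
unfold ray; eapply Rle_lt_trans; [apply Cnorm_add|].
rewrite Cnorm_mul, Cnorm_RtoC, Rabs_pos_eq by exact Hs0; nra.
Qed.

Section MonotoneImage.

Variable f : Cplx -> Cplx.
Hypotheses (f_monotone : strictly_monotone_on_D f) (f_continuous : ray_continuous_on_D f).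

(** Minty's trick: testing at [z + s u] with [u = w - f z] and small [s > 0] gives
    [<w - f (z + s u), u> <= 0]. By continuity along the ray the left side is close to [<u, u>], so
    [u = 0]. *)
Lemma solves_interior (w z : Cplx) : inD z -> solves f w z -> f z = w.
Proof.
intros Hz Hsol; set (u := Csub w (f z)).
destruct (classic (u = C0)) as [E|E].
{ replace w with (Cadd (f z) u) by (unfold u; ring); rewrite E; ring. }
exfalso; assert (Hu := dot_gt0 u E).
destruct (inD_ray_near z u Hz) as [d1 [Hd1 Hray]].
destruct (f_continuous z u Hz (dot u u) Hu) as [d2 [Hd2 Hcont]].
set (s := Rmin d1 d2 / 2).
assert (Hmin : 0 < Rmin d1 d2) by (apply Rmin_glb_lt; assumption).
assert (Rmin d1 d2 <= d1) by apply Rmin_l.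
assert (Rmin d1 d2 <= d2) by apply Rmin_r.
assert (Hs : 0 < s < d1 /\ s < d2) by (unfold s; lra).
assert (Hsol' := Hsol _ (Hray s ltac:(lra))).
assert (Hc : Rabs (dot (f (ray z u s)) u - dot (f (ray z u 0)) u) < dot u u).
{ apply Hcont; split.
  - unfold D_x, no_cond; split; [exact I | lra].
  - simpl; unfold Rdist; rewrite Rminus_0_r, Rabs_pos_eq; lra. }
rewrite ray_0 in Hc; apply Rabs_def2 in Hc.
assert (Hle : s * (dot w u - dot (f (ray z u s)) u) <= 0).
{ replace (s * _) with (- dot (Csub w (f (ray z u s))) (Csub z (ray z u s))); [lra|].
  unfold ray at 2, dot, Csub, Cadd, Copp, Cmul, RtoC; simpl; ring. }
assert (Hwu : dot w u = dot (f z) u + dot u u)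
  by (unfold u, dot, Csub, Cadd, Copp; simpl; ring).
rewrite Hwu in Hle; nra.
Qed.

(** The test point is the midpoint [m] of [z] and [zeta]. Since [zeta - m = m - z], the inequality
    at [m] with [w = f z] contradicts strict monotonicity between [z] and [m]. *)
Lemma solves_circle_not_image (w z zeta : Cplx) :
  inD z -> dot zeta zeta = 1 -> solves f w zeta -> f z <> w.
Proof.
intros Hz Hzeta Hsol E.
set (m := segment z zeta (1 / 2)).
assert (Hz' := proj1 (inD_dot z) Hz).
assert (Hm : inD m) by (apply inD_dot, segment_open_disc; lra).
assert (Hne : z <> m).
{ intros Em.
  assert (Ez : zeta = z).
  { replace zeta with (Cadd z (Cmul (RtoC 2) (Csub m z))).
    - rewrite <- Em; ring.
    - unfold m, segment, ray, Csub, Cadd, Copp, Cmul, RtoC; destruct z, zeta; simpl; f_equal; field. }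
  rewrite Ez in Hzeta; lra. }
assert (H1 := f_monotone z m Hz Hm Hne); assert (H2 := Hsol m Hm); rewrite <- E in H2.
revert H1 H2; unfold m at 2 4, segment, ray, dot, Csub, Cadd, Copp, Cmul, RtoC; simpl; lra.
Qed.

Lemma not_image_solves (w : Cplx) :
  ~ (exists z, inD z /\ f z = w) <-> exists zeta, dot zeta zeta = 1 /\ solves f w zeta.
Proof.
split.
- intros Hno; destruct (solvable_in_closed_disc f w f_monotone) as [zeta [[Hlt|He] Hsol]].
  + exfalso; apply Hno; exists zeta; split; [apply inD_dot, Hlt|].
    apply solves_interior; [apply inD_dot, Hlt | exact Hsol].
  + exists zeta; auto.
- intros [zeta [He Hsol]] [z [Hz E]]; exact (solves_circle_not_image w z zeta Hz He Hsol E).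
Qed.

(** The midpoint of two solutions is again a solution. If they are distinct points of the circle it
    lies inside the disc, so [w] is a value of [f], which a solution on the circle excludes. *)
Lemma solves_circle_unique (w z1 z2 : Cplx) :
  dot z1 z1 = 1 -> dot z2 z2 = 1 -> solves f w z1 -> solves f w z2 -> z1 = z2.
Proof.
intros H1 H2 S1 S2; apply NNPP; intros Hne.
assert (Hd : 0 < dot (Csub z2 z1) (Csub z2 z1)).
{ apply dot_gt0; intros E; apply Hne.
  replace z2 with (Cadd z1 (Csub z2 z1)) by ring; rewrite E; ring. }
set (m := segment z1 z2 (1 / 2)).
assert (Hm : inD m).
{ apply inD_dot; unfold m; rewrite dot_segment.
  replace (dot (Csub z2 z1) (Csub z2 z1)) with (dot z1 z1 + dot z2 z2 - 2 * dot z1 z2) in Hd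
    by (unfold dot, Csub, Cadd, Copp; simpl; ring).
  lra. }
apply (solves_circle_not_image w m z1 Hm H1 S1), solves_interior; [exact Hm|].
intros z Hz; assert (A1 := S1 z Hz); assert (A2 := S2 z Hz).
revert A1 A2; unfold m, segment, ray, dot, Csub, Cadd, Copp, Cmul, RtoC; simpl; lra.
Qed.

(** The direction [d] is the outward normal of the disc at its point [d], so [<d, d - z> >= 0] for
    every [z] of the disc, and moving [p] along [d] only increases each product. *)
Lemma solves_ray (p d : Cplx) (t : R) :
  dot d d = 1 -> 0 <= t -> solves f p d -> solves f (ray p d t) d.
Proof.
intros Hd Ht Hsol z Hz; assert (H := Hsol z Hz).
assert (Hdz : 0 <= dot d (Csub d z)).
{ apply inD_dot in Hz; assert (M := dot_le_mean d z).
  revert Hd Hz M; unfold dot, Csub, Cadd, Copp; simpl; lra. }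
replace (dot _ _) with (dot (Csub p (f z)) (Csub d z) + t * dot d (Csub d z))
  by (unfold ray, dot, Csub, Cadd, Copp, Cmul, RtoC; simpl; ring).
apply Rplus_le_le_0_compat; [exact H | apply Rmult_le_pos; assumption].
Qed.

(** Base points of the half-lines that cannot be prolonged backwards. Keeping only these maximal
    half-lines makes two of the same direction coincide as soon as they meet. *)
Definition endpoint (p d : Cplx) : Prop :=
  dot d d = 1 /\ solves f p d /\ forall t, 0 < t -> ~ solves f (ray p d (- t)) d.

(** Let [m] be the supremum of the lengths by which [w] can be moved back. It is finite by the test
    at the origin, and it is attained because each inequality bounds the length by a closed
    condition. *)
Lemma solves_endpoint (w d : Cplx) :
  dot d d = 1 -> solves f w d -> exists p, endpoint p d /\ halfline p d w.
Proof.
intros Hd Hsol.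
set (E := fun t => solves f (ray w d (- t)) d).
destruct (completeness E) as [m [Hub Hlub]].
{ exists (dot (Csub w (f C0)) d); intros t Ht.
  assert (H0 : inD C0) by (apply inD_dot; unfold dot; simpl; lra).
  specialize (Ht C0 H0); revert Ht.
  replace (dot _ _) with (dot (Csub w (f C0)) d - t * dot d d)
    by (unfold ray, dot, Csub, Cadd, Copp, Cmul, RtoC, C0; simpl; ring).
  rewrite Hd; lra. }
{ exists 0; unfold E; rewrite Ropp_0, ray_0; exact Hsol. }
assert (Hm0 : 0 <= m) by (apply Hub; unfold E; rewrite Ropp_0, ray_0; exact Hsol).
exists (ray w d (- m)); split; [split; [exact Hd|split]|].
- intros z Hz; apply Rnot_lt_le; intros Hneg.
  assert (Hform : forall t, dot (Csub (ray w d (- t)) (f z)) (Csub d z)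
    = dot (Csub w (f z)) (Csub d z) - t * dot d (Csub d z))
    by (intros t; unfold ray, dot, Csub, Cadd, Copp, Cmul, RtoC; simpl; ring).
  rewrite Hform in Hneg.
  assert (Hdz : 0 < dot d (Csub d z)).
  { apply inD_dot in Hz; assert (M := dot_le_mean d z).
    revert Hd Hz M; unfold dot, Csub, Cadd, Copp; simpl; lra. }
  set (c := dot (Csub w (f z)) (Csub d z)) in *.
  assert (Hmc : m <= c / dot d (Csub d z)).
  { apply Hlub; intros t Ht; specialize (Ht z Hz); rewrite Hform in Ht; fold c in Ht.
    apply Rle_div_r; [exact Hdz | lra]. }
  apply Rle_div_r in Hmc; [lra | exact Hdz].
- intros t Ht Hs.
  assert (Hle : m + t <= m); [|lra].
  apply Hub; unfold E; replace (ray w d (- (m + t))) with (ray (ray w d (- m)) d (- t));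
    [exact Hs|].
  unfold ray, Cadd, Cmul, RtoC; simpl; f_equal; ring.
- exists m; split; [lra|].
  unfold ray, Cadd, Cmul, RtoC; destruct w; simpl; f_equal; ring.
Qed.

Lemma halfline_solves (p d w : Cplx) : endpoint p d -> halfline p d w -> solves f w d.
Proof.
intros [Hd [Hsol _]] [t [Ht ->]]; apply (solves_ray p d t Hd); [lra | exact Hsol].
Qed.

(** Both base points lie on one line of direction [d]. If they differed, the one further along [d]
    could be moved back to the other, against maximality. *)
Lemma endpoint_unique (p1 p2 d w : Cplx) :
  endpoint p1 d -> endpoint p2 d -> halfline p1 d w -> halfline p2 d w -> p1 = p2.
Proof.
intros [_ [S1 M1]] [_ [S2 M2]] [t1 [_ E1]] [t2 [_ E2]].
assert (E12 : p1 = ray p2 d (- (t1 - t2))).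
{ rewrite E1 in E2; destruct p1, p2, d; injection E2 as E2 E3.
  unfold ray, Cadd, Cmul, RtoC; simpl in *; f_equal; lra. }
assert (E21 : p2 = ray p1 d (- (t2 - t1))).
{ rewrite E12; unfold ray, Cadd, Cmul, RtoC; destruct p2; simpl; f_equal; ring. }
destruct (Rtotal_order t1 t2) as [H|[H|H]].
- exfalso; apply (M1 (t2 - t1)); [lra|]; rewrite <- E21; exact S2.
- subst t2; rewrite E12; replace (t1 - t1) with 0 by ring; rewrite Ropp_0; apply ray_0.
- exfalso; apply (M2 (t1 - t2)); [lra|]; rewrite <- E12; exact S1.
Qed.

Lemma strictly_monotone_univalent : univalent_on_D f.
Proof.
intros z1 z2 H1 H2 E; apply NNPP; intros Hne.
assert (H := f_monotone z1 z2 H1 H2 Hne); rewrite E in H.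
revert H; unfold dot, Csub, Cadd, Copp; simpl; lra.
Qed.

Lemma strictly_monotone_close_to_convex : close_to_convex f.
Proof.
split; [exact strictly_monotone_univalent|].
exists endpoint; split; [|split].
- intros p d [Hd _] E; subst d; unfold dot in Hd; simpl in Hd; lra.
- intros w; rewrite not_image_solves; split.
  + intros [d [Hd Hsol]]; destruct (solves_endpoint w d Hd Hsol) as [p Hp].
    exists p, d; exact Hp.
  + intros [p [d [He Hw]]]; exists d; split; [apply He | exact (halfline_solves p d w He Hw)].
- intros p1 d1 p2 d2 He1 He2.
  destruct (classic (exists w, halfline p1 d1 w /\ halfline p2 d2 w)) as [[w [Hw1 Hw2]]|Hno].
  + left.
    (* The directions are points of the circle solving the same [w], hence equal. *)
    assert (Ed : d1 = d2) by exact (solves_circle_unique w d1 d2 (proj1 He1) (proj1 He2)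
      (halfline_solves _ _ _ He1 Hw1) (halfline_solves _ _ _ He2 Hw2)).
    subst d2; rewrite (endpoint_unique p1 p2 d1 w He1 He2 Hw1 Hw2); tauto.
  + right; intros w Hw; apply Hno; exists w; exact Hw.
Qed.

End MonotoneImage.

Theorem theorem2p4 (alpha beta : R) (a b : nat -> Cplx) :
  alpha >= 0 -> 0 <= beta < 1 -> in_WH0 alpha beta a b ->
  close_to_convex (harm a b) /\ univalent_on_D (harm a b).
Proof.
intros Halpha Hbeta HW.
assert (Hmon := WH0_strictly_monotone alpha beta a b Halpha (proj1 Hbeta) HW).
destruct HW as [[_ [_ [_ [_ [Ha Hb]]]]] _].
split; [|apply strictly_monotone_univalent; exact Hmon].
apply strictly_monotone_close_to_convex; [exact Hmon|].
(* Continuity along rays follows from the derivative along rays, taken at parameter 0. *)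
intros z u Hz; apply derivable_continuous_pt; eexists.
apply harm_derive_ray; [exact Ha | exact Hb | rewrite ray_0; exact Hz].
Qed.
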